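(* Let $K$ be a set of a metric space and let $W, W_0 : K \to \mathbb{R}$ be functionals with $W(x) \neq 0$ for all $x \in K$. For $x \in K$ and $\beta \in \mathbb{R}$ put $$J(x) = \frac{W_0(x)}{W(x)}, \qquad J_\beta(x) = W(x)\bigl(W_0(x) - \beta W(x)\bigr).$$ Suppose that $J$ has a maximizer $x_{\max} \in K$ over $K$ and that for every $\beta \in \mathbb{R}$ the functional $J_\beta$ has a maximizer $x_\beta \in K$ over $K$. Put $\beta_{\max} = J(x_{\max})$ and $j(\beta) = J_\beta(x_\beta)$. Then: (1) $j(\beta) < 0$ for $\beta > \beta_{\max}$, $j(\beta) > 0$ for $\beta < \beta_{\max}$, and $j(\beta_{\max}) = 0$; so $\beta_{\max}$ is the only solution of the equation $j(\beta) = 0$. (2) The functionals $J$ and $J_{\beta_{\max}}$ take their maxima over $K$ at the same point: $x_{\max}$ is also a maximizer of $J_{\beta_{\max}}$ over $K$, i.e. one can take $x_{\beta_{\max}} = x_{\max}$.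
   Context: All functionals are real-valued; no continuity or compactness is assumed. Maximizers need not be unique; $x_{\max}$ and $x_\beta$ denote arbitrary chosen maximizers. The value $j(\beta) = \max_{x\in K} J_\beta(x)$ does not depend on the choice of $x_\beta$, and $\beta_{\max} = \max_{x\in K} J(x)$ does not depend on the choice of $x_{\max}$. *)

(* Defs.v *)
(* MathComp-Analysis *)
From HB Require Import structures.
From mathcomp Require Import all_boot all_order all_algebra.
From mathcomp Require Import all_classical all_reals all_analysis.

Set Implicit Arguments.
Unset Strict Implicit.
Unset Printing Implicit Defensive.

Import Order.TTheory GRing.Theory Num.Theory.
Local Open Scope classical_set_scope.
Local Open Scope ring_scope.

(* K : set T is used as a type through the coercion set_type, so that the
   functionals are defined on K only and points x : K lie in K. *)

Definition maximizer (R : realType) (T : Type) (K : set T) (F : K -> R)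
  (x : K) : Prop := forall y : K, F y <= F x.

Definition quotientJ (R : realType) (T : Type) (K : set T) (W W0 : K -> R)
  (x : K) : R := W0 x / W x.

Definition Jbeta (R : realType) (T : Type) (K : set T) (W W0 : K -> R)
  (beta : R) (x : K) : R := W x * (W0 x - beta * W x).

(* Main.v *)
Require Import Defs.
From mathcomp Require Import all_boot all_order all_algebra.
From mathcomp Require Import all_classical all_reals all_analysis.
Import Order.TTheory GRing.Theory Num.Theory.
Local Open Scope classical_set_scope.
Local Open Scope ring_scope.

(** The whole argument rests on the identity J_beta = W^2 (J - beta): since
    W^2 > 0, the number J_beta x has the sign of J x - beta at every point x
    ([Jbeta_quotientJ], [Jbeta_lt0], [Jbeta_gt0]).  If beta exceeds the maximum
    bmax of J, then J_beta is negative at every point, in particular at its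
    maximizer; if beta < bmax, then J_beta is positive at xmax, so its maximum
    is positive.  At beta = bmax the functional J_bmax is nowhere positive and
    vanishes at xmax, which is therefore one of its maximizers, and the maximal
    value is 0. *)

Lemma Jbeta_quotientJ (R : realType) (T : Type) (K : set T) (W W0 : K -> R)
    (beta : R) (x : K) :
  W x != 0 -> Jbeta W W0 beta x = W x ^+ 2 * (quotientJ W W0 x - beta).
Proof.
move=> Wx; rewrite /Jbeta /quotientJ expr2 -mulrA; congr (_ * _).
by rewrite mulrBr mulrCA divff // mulr1 (mulrC beta).
Qed.

Lemma Jbeta_lt0 (R : realType) (T : Type) (K : set T) (W W0 : K -> R)
    (beta : R) (x : K) :
  W x != 0 -> (Jbeta W W0 beta x < 0) = (quotientJ W W0 x < beta).
Proof.
by move=> Wx; rewrite Jbeta_quotientJ // pmulr_rlt0 ?exprn_even_gt0 // subr_lt0.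
Qed.

Lemma Jbeta_gt0 (R : realType) (T : Type) (K : set T) (W W0 : K -> R)
    (beta : R) (x : K) :
  W x != 0 -> (0 < Jbeta W W0 beta x) = (beta < quotientJ W W0 x).
Proof.
by move=> Wx; rewrite Jbeta_quotientJ // pmulr_rgt0 ?exprn_even_gt0 // subr_gt0.
Qed.

Theorem theorem2 (R : realType) (T : metricType R) (K : set T)
  (W W0 : K -> R) (W_neq0 : forall x : K, W x <> 0)
  (xmax : K) (xmaxP : maximizer (quotientJ W W0) xmax)
  (xbeta : R -> K)
  (xbetaP : forall beta : R, maximizer (Jbeta W W0 beta) (xbeta beta)) :
  let bmax : R := quotientJ W W0 xmax in
  let j : R -> R := fun beta => Jbeta W W0 beta (xbeta beta) in
  ((forall beta : R, bmax < beta -> j beta < 0) /\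
   (forall beta : R, beta < bmax -> 0 < j beta) /\
   j bmax = 0 /\
   (forall beta : R, j beta = 0 -> beta = bmax)) /\
  maximizer (Jbeta W W0 bmax) xmax.
Proof.
move=> bmax j.
have Wn0 x : W x != 0 by apply/eqP.
have j_lt0 beta : bmax < beta -> j beta < 0.
  by move=> hb; rewrite Jbeta_lt0 //; apply: le_lt_trans (xmaxP _) hb.
have j_gt0 beta : beta < bmax -> 0 < j beta.
  by move=> hb; apply: lt_le_trans (xbetaP beta xmax); rewrite Jbeta_gt0.
have Jbmax_xmax : Jbeta W W0 bmax xmax = 0.
  by rewrite Jbeta_quotientJ // subrr mulr0.
have Jbmax_le0 x : Jbeta W W0 bmax x <= 0.
  by rewrite leNgt Jbeta_gt0 // -leNgt; apply: xmaxP.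
split; last by move=> x; rewrite Jbmax_xmax.
split=> //; split=> //; split.
  by apply/le_anti; rewrite Jbmax_le0 -Jbmax_xmax; apply: xbetaP.
move=> beta jb0; case: (ltgtP beta bmax) => // hb.
- by move: (j_gt0 _ hb); rewrite jb0 ltxx.
- by move: (j_lt0 _ hb); rewrite jb0 ltxx.
Qed.
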